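(* Let $d\ge1$, let $F:\mathbb{R}\to[0,1]$ be a univariate CDF, let $\alpha>0$, let $f:\mathbb{R}^d\to\mathbb{R}$ be of class $C^d$, let $\pi$ be a probability density on $\mathbb{R}^d$ of class $C^d$, and let $\boldsymbol\tau:(0,1)^d\to\mathbb{R}^d$ be a diffeomorphism of class $C^{d+1}$. Assume: (i) for every multi-index $\lambda\in\mathbb{N}_0^d$ with $|\lambda|\le d$ and every $B>0$ there is $C_1>0$ with $|\partial^\lambda f(\mathbf x)|\le C_1\prod_{k=1}^d[\min(F(x_k),1-F(x_k))]^{-B}$ for all $\mathbf x\in\mathbb{R}^d$; (ii) there is $C_2>0$ such that for every multi-index $\lambda\in\mathbb{N}_0^d$ with $|\lambda|\le d$, $|\partial^\lambda\pi(\mathbf x)|\le C_2\prod_{k=1}^d e^{-\alpha|x_k|}$ for all $\mathbf x\in\mathbb{R}^d$; (iii) $\boldsymbol\tau$ satisfies the transport growth assumption with respect to $F$ and $\alpha$ (see context). Then $h(\mathbf u)=f(\boldsymbol\tau(\mathbf u))\,\pi(\boldsymbol\tau(\mathbf u))\,|\det J_{\boldsymbol\tau}(\mathbf u)|$ satisfies the boundary growth condition: for every $B>0$ there is $C>0$ such that for all $v\subseteq\{1,\dots,d\}$ and all $\mathbf u\in(0,1)^d$, $$|\partial^v h(\mathbf u)|\le C\prod_{j=1}^d[\min(u_j,1-u_j)]^{-B-\mathbf 1_{\{j\in v\}}} .$$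
   Context: For $v\subseteq\{1,\dots,d\}$, $\partial^v=\prod_{j\in v}\partial/\partial u_j$ (with $\partial^\emptyset$ the identity); for a multi-index $\lambda$, $\partial^\lambda$ is the usual partial derivative of order $|\lambda|=\sum_i\lambda_i$. $J_{\boldsymbol\tau}=(\partial\boldsymbol\tau_i/\partial u_j)_{i,j}$. Negative powers of $0$ are read as $+\infty$. Transport growth assumption with respect to $F$ and $\alpha$: (a) for all $v\subseteq\{1,\dots,d\}$, all $m,j\in\{1,\dots,d\}$ and every $B>0$ there is $C_3>0$ such that for all $\mathbf u\in(0,1)^d$, $$|\partial^v(\partial^{\{m\}}\boldsymbol\tau_j)(\mathbf u)|\le C_3\min(u_m,1-u_m)^{-1}\prod_{k=1}^d\min(u_k,1-u_k)^{-B-\mathbf 1_{\{k\in v\}}};$$ (b) there are constants $B_0>0$, $C_4>0$ such that for all $k\in\{1,\dots,d\}$ and $\mathbf u\in(0,1)^d$, $$\min\big(F(\boldsymbol\tau_k(\mathbf u)),1-F(\boldsymbol\tau_k(\mathbf u))\big)^{-1}\le C_4\prod_{l=1}^d\min(u_l,1-u_l)^{-B_0};$$ (c) there are constants $C_5>1/\alpha$ and $C'\in\mathbb{R}$ such that for all $j\in\{1,\dots,d\}$ and $\mathbf u\in(0,1)^d$, $|\boldsymbol\tau_j(\mathbf u)|\ge C_5|\ln(\min(u_j,1-u_j))|-C'$. *)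

(* Defs.v *)
From HB Require Import structures.
From mathcomp Require Import all_boot all_order all_algebra.
From mathcomp Require Import all_classical all_reals all_analysis.

Set Implicit Arguments.
Unset Strict Implicit.
Unset Printing Implicit Defensive.

Import Order.TTheory GRing.Theory Num.Theory.
Import numFieldNormedType.Exports.

Local Open Scope classical_set_scope.
Local Open Scope ring_scope.

(* Points of R^d are row vectors 'rV[R]_d.  Functions on the open cube are total
   functions whose values outside the cube are irrelevant: all derivatives below
   are only taken at points of an open set and are local. *)

Definition ucube (R : realType) (d : nat) : set 'rV[R]_d :=
  [set u | forall i, 0 < u ord0 i < 1].

Definition coord_fun (R : realType) (m d : nat) (g : 'rV[R]_m -> 'rV[R]_d)
    (j : 'I_d) : 'rV[R]_m -> R :=
  fun u => g u ord0 j.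

Definition partial (R : realType) (d : nat) (j : 'I_d) (g : 'rV[R]_d -> R) :
    'rV[R]_d -> R :=
  fun x => 'D_(delta_mx ord0 j) g x.

Definition partial_set (R : realType) (d : nat) (v : {set 'I_d})
    (g : 'rV[R]_d -> R) : 'rV[R]_d -> R :=
  foldr (@partial R d) g (enum v).

Definition partial_multi (R : realType) (d : nat) (l : {ffun 'I_d -> nat})
    (g : 'rV[R]_d -> R) : 'rV[R]_d -> R :=
  foldr (fun j => iter (l j) (@partial R d j)) g (enum 'I_d).

(* Class C^k on an open set U: all partial derivatives of order at most k exist
   and are continuous on U. *)
Fixpoint classC (R : realType) (d : nat) (k : nat) (U : set 'rV[R]_d)
    (g : 'rV[R]_d -> R) : Prop :=
  (forall x, U x -> {for x, continuous g}) /\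
  (if k is k'.+1 then
     forall j : 'I_d,
       (forall x, U x -> derivable g x (delta_mx ord0 j)) /\
       classC k' U (partial j g)
   else True).

Definition diffeomorphism (R : realType) (d : nat) (k : nat)
    (U V : set 'rV[R]_d) (tau : 'rV[R]_d -> 'rV[R]_d) : Prop :=
  [/\ set_bij U V tau,
      forall j, classC k U (coord_fun tau j) &
      exists sigma : 'rV[R]_d -> 'rV[R]_d,
        (forall u, U u -> sigma (tau u) = u) /\
        (forall j, classC k V (coord_fun sigma j))].

Definition jac (R : realType) (d : nat) (tau : 'rV[R]_d -> 'rV[R]_d)
    (u : 'rV[R]_d) : 'M[R]_d :=
  \matrix_(i, j) partial j (coord_fun tau i) u.

Definition edge (R : realType) (x : R) : R := Num.min x (1 - x).

(* x to the power -b for x >= 0 and b > 0, with value +oo at x = 0, whereas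
   powR gives 0 there. *)
Definition negpow (R : realType) (x b : R) : \bar R :=
  if x == 0 then +oo%E else (x `^ (- b))%:E.

Section product_tuple.
Context d (T : measurableType d) (R : realType).
Variable m : {sigma_finite_measure set T -> \bar R}.

Let cons_pair n (x : T * n.-tuple T) : n.+1.-tuple T :=
  [the n.+1.-tuple T of x.1 :: x.2].

Section step.
Context n (mu : {sigma_finite_measure set (n.-tuple T) -> \bar R}).

Let measurable_cons_pair : measurable_fun setT (@cons_pair n).
Proof. exact: measurable_cons. Qed.

Let measurable_preimage A :
  measurable A -> measurable (@cons_pair n @^-1` A).
Proof. by move=> mA; rewrite -[X in measurable X]setTI; exact: measurable_cons_pair. Qed.

Definition cons_measure : set (n.+1.-tuple T) -> \bar R :=
  pushforward (m \x mu)%E (@cons_pair n).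

Let cons_measure0 : cons_measure set0 = 0%E.
Proof. by rewrite /cons_measure /pushforward preimage_set0 measure0. Qed.

Let cons_measure_ge0 A : (0 <= cons_measure A)%E.
Proof. exact: (@measure_ge0 _ _ _ (m \x mu)%E). Qed.

Let cons_measure_sigma_additive : semi_sigma_additive cons_measure.
Proof.
move=> F mF tF mUF; rewrite /cons_measure /pushforward preimage_bigcup.
apply: (@measure_semi_sigma_additive _ _ _ (m \x mu)%E).
- by move=> k; exact: measurable_preimage.
- apply/trivIsetP => /= i j _ _ ij; rewrite -preimage_setI.
  by move/trivIsetP : tF => /(_ _ _ _ _ ij) ->//; rewrite preimage_set0.
- by rewrite -preimage_bigcup; exact: measurable_preimage.
Qed.

HB.instance Definition _ := isMeasure.Build _ _ _ cons_measure
  cons_measure0 cons_measure_ge0 cons_measure_sigma_additive.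

Let uncons (t : n.+1.-tuple T) : T * n.-tuple T :=
  (thead t, [tuple of behead t]).

Let measurable_uncons : measurable_fun setT uncons.
Proof.
apply/measurable_fun_pairP; split; last exact: measurable_behead.
exact: measurable_tnth.
Qed.

Let uncons_preimage (A : set (T * n.-tuple T)) :
  @cons_pair n @^-1` (uncons @^-1` A) = A.
Proof.
have unconsK x : uncons (cons_pair x) = x.
  by case: x => x t; congr pair; exact: val_inj.
by apply/seteqP; split=> x /=; rewrite unconsK.
Qed.

Let cons_measure_sigma_finite : sigma_finite setT cons_measure.
Proof.
have /sigma_finiteP[F [TF ndF Foo]] := sigma_finiteT m.
have /sigma_finiteP[G [TG ndG Goo]] := sigma_finiteT mu.
exists (fun k => uncons @^-1` (F k `*` G k)) => [|k].
  apply/esym; rewrite -subTset => t _.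
  have [i _ Fi] : (\bigcup_i F i) (thead t) by rewrite -TF.
  have [j _ Gj] : (\bigcup_i G i) [tuple of behead t] by rewrite -TG.
  exists (maxn i j) => //; split.
  - by move: Fi; exact/subsetPset/ndF/leq_maxl.
  - by move: Gj; exact/subsetPset/ndG/leq_maxr.
have [mF Fk] := Foo k; have [mG Gk] := Goo k.
rewrite /cons_measure /pushforward uncons_preimage; split.
  rewrite -[X in measurable X]setTI.
  by apply: measurable_uncons => //; exact: measurableX.
by rewrite product_measure1E// lte_mul_pinfty// ge0_fin_numE.
Qed.

HB.instance Definition _ := Measure_isSigmaFinite.Build _ _ _ cons_measure
  cons_measure_sigma_finite.

End step.

(* n-fold product measure; cons_measure is m \x mu transported along
   (x, t) |-> x :: t. *)
Fixpoint product_tuple n : {sigma_finite_measure set (n.-tuple T) -> \bar R} :=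
  if n is k.+1 then cons_measure (product_tuple k) else \d_([tuple] : 0.-tuple T).

End product_tuple.

(* R^d is identified with d.-tuple R, which carries the product sigma-algebra. *)
Definition probability_density (R : realType) (d : nat)
    (p : 'rV[R]_d -> R) : Prop :=
  (forall x, 0 <= p x) /\
  (\int[product_tuple (@lebesgue_measure R) d]_t
     (p (\row_j tnth t j))%:E = 1)%E.

Definition transport_growth (R : realType) (d : nat) (F : R -> R) (alpha : R)
    (tau : 'rV[R]_d -> 'rV[R]_d) : Prop :=
  [/\ forall (v : {set 'I_d}) (m j : 'I_d) (B : R), 0 < B ->
        exists2 C3 : R, 0 < C3 & forall u, ucube u ->
          `|partial_set v (partial m (coord_fun tau j)) u| <=
            C3 * (edge (u ord0 m))^-1 *
            \prod_(k < d) edge (u ord0 k) `^ (- B - (k \in v)%:R),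
      exists B0 C4 : R, [/\ 0 < B0, 0 < C4 &
        forall (k : 'I_d) u, ucube u ->
          (negpow (edge (F (tau u ord0 k))) 1 <=
            (C4 * \prod_(l < d) edge (u ord0 l) `^ (- B0))%:E)%E] &
      exists C5 C' : R, alpha^-1 < C5 /\
        forall (j : 'I_d) u, ucube u ->
          C5 * `|ln (edge (u ord0 j))| - C' <= `|tau u ord0 j| ].

(* The first clause says that the mixed partial derivatives of h on the cube
   exist; without it partial_set could be a default value. *)
Definition boundary_growth (R : realType) (d : nat) (h : 'rV[R]_d -> R) : Prop :=
  (forall (v : {set 'I_d}) (j : 'I_d) u, j \notin v -> ucube u ->
     derivable (partial_set v h) u (delta_mx ord0 j)) /\
  (forall B : R, 0 < B -> exists2 C : R, 0 < C &
     forall (v : {set 'I_d}) u, ucube u ->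
       `|partial_set v h u| <=
         C * \prod_(j < d) edge (u ord0 j) `^ (- B - (j \in v)%:R)).

(* Main.v *)
(* Call g of order c on the cube if, up to arbitrarily small extra powers, each
   mixed derivative of g along a set of distinct coordinates is bounded by
   prod_k edge(u_k)^(c_k), each derivative in direction j costing one power of
   edge(u_j).  Orders add under products (Leibniz).  The entry d_m tau_j of the
   Jacobian has order -e_m by assumption (a), so det J has order (-1, ..., -1).
   By the chain rule f o tau has order 0, because (b) turns the growth of f into
   arbitrarily small powers of edge, and p o tau has order
   (alpha C5, ..., alpha C5), because (c) turns exponential decay into powers of
   edge.  Since alpha C5 > 1, the product has order at least 0.  The absolute
   value is harmless: det J never vanishes, so it has constant sign on the
   convex cube.  The chain rule yields derivatives of f and p in every order of
   the directions; symmetry of mixed partials brings them to the multi-index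
   form in which the assumptions are stated. *)
Require Import Defs.
From HB Require Import structures.
From mathcomp Require Import all_boot all_order all_algebra.
From mathcomp Require Import all_classical all_reals all_analysis.
From mathcomp Require Import perm ring lra.

Set Implicit Arguments.
Unset Strict Implicit.
Unset Printing Implicit Defensive.

Import Order.TTheory GRing.Theory Num.Theory.
Import numFieldNormedType.Exports.

Local Open Scope classical_set_scope.
Local Open Scope ring_scope.

(** * Directional derivatives and a mean value estimate *)

Lemma is_derive_cvg (R : realType) (V : normedModType R) (f : V -> R)
    (x v : V) (df : R) :
  h^-1 * (f (h *: v + x) - f x) @[h --> (0 : R)^'] --> df -> is_derive x v f df.
Proof.
move=> fdf; split; last exact: (cvg_lim (@Rhausdorff R)).
by apply/cvg_ex; exists df.
Qed.

Lemma derivable_cvg (R : realType) (V : normedModType R) (f : V -> R)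
    (x v : V) :
  derivable f x v ->
  h^-1 * (f (h *: v + x) - f x) @[h --> (0 : R)^'] --> 'D_v f x.
Proof. by []. Qed.

Lemma is_derive_line (R : realType) (V : normedModType R) (f : V -> R)
    (x v : V) (s : R) :
  derivable f (x + s *: v) v ->
  is_derive s (1 : R) (fun t : R => f (x + t *: v)) ('D_v f (x + s *: v)).
Proof.
move=> /derivable_cvg fv; apply: is_derive_cvg.
by under eq_fun do rewrite scaler1 scalerDl addrCA.
Qed.

(** The mean value theorem gives [h t - h 0 = t * dh c] with [c] between [0] and [t]. Hypotheses on
    [|s| <= |t|] cover both signs of [t] at once. *)
Lemma mean_value_ineq (R : realType) (h dh : R -> R) (a e t : R) :
  (forall s : R, `|s| <= `|t| -> is_derive s (1 : R) h (dh s)) ->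
  (forall s : R, `|s| <= `|t| -> `|dh s - a| <= e) ->
  `|h t - h 0 - t * a| <= `|t| * e.
Proof.
move=> hd hb.
have [t0|t0] := leP 0 t.
- have hc : {within `[0, t], continuous h}.
    apply: derivable_within_continuous => s; rewrite in_itv/= => /andP[s0 st].
    by have [] := hd s; rewrite ?ger0_norm.
  have h0t s : s \in `]0, t[ -> is_derive s (1 : R) h (dh s).
    rewrite in_itv/= => /andP[/ltW s0 /ltW st].
    by apply: hd; rewrite !ger0_norm.
  have [c] := MVT_segment t0 h0t hc.
  rewrite in_itv/= => /andP[c0 ct] ->.
  have -> : dh c * (t - 0) - t * a = t * (dh c - a) by ring.
  by rewrite normrM ler_wpM2l// hb// !ger0_norm.
- have hc : {within `[t, 0], continuous h}.
    apply: derivable_within_continuous => s; rewrite in_itv/= => /andP[ts s0].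
    have [] // := hd s; rewrite !ler0_norm ?lerN2//; exact: ltW.
  have ht0 s : s \in `]t, 0[ -> is_derive s (1 : R) h (dh s).
    rewrite in_itv/= => /andP[/ltW ts /ltW s0].
    by apply: hd; rewrite !ler0_norm ?lerN2//; exact: ltW.
  have [c] := MVT_segment (ltW t0) ht0 hc.
  rewrite in_itv/= => /andP[tc c0] hE.
  have -> : h t - h 0 - t * a = t * (dh c - a).
    by rewrite -(opprB (h 0)) hE; ring.
  by rewrite normrM ler_wpM2l// hb// !ler0_norm ?lerN2//; exact: ltW.
Qed.

(** * Neighbourhoods of row vectors and the classes C^k *)

Lemma nbhs_rowP (R : realType) (d : nat) (x : 'rV[R]_d) (P : set 'rV[R]_d) :
  nbhs x P <-> exists2 e : R, 0 < e &
    forall y : 'rV[R]_d, (forall k, `|x ord0 k - y ord0 k| < e) -> P y.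
Proof.
split=> [/nbhs_ballP|] [e e0 eP].
  by exists e => // y xy; apply: eP; split=> // i j; rewrite ord1; exact: xy.
by apply/nbhs_ballP; exists e => // y [_ xy]; apply: eP => k; exact: xy.
Qed.

Lemma classC_continuous (R : realType) (d k : nat) (U : set 'rV[R]_d) g x :
  classC k U g -> U x -> {for x, continuous g}.
Proof. by case: k => [|k] [cg _]; exact: cg. Qed.

Lemma classC_derivable (R : realType) (d k : nat) (U : set 'rV[R]_d) g j x :
  classC k.+1 U g -> U x -> derivable g x (delta_mx ord0 j).
Proof. by move=> [_ /(_ j)[dg _]]; exact: dg. Qed.

Lemma classC_partial (R : realType) (d k : nat) (U : set 'rV[R]_d) g j :
  classC k.+1 U g -> classC k U (partial j g).
Proof. by move=> [_ /(_ j)[]]. Qed.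

Lemma classCS (R : realType) (d k : nat) (U : set 'rV[R]_d) g :
  classC k.+1 U g -> classC k U g.
Proof.
elim: k g => [|k ih] g [cg dg]; split=> // j; have [dgj cgj] := dg j.
by split=> //; exact: ih.
Qed.

Lemma classCW (R : realType) (d k l : nat) (U : set 'rV[R]_d) g :
  (l <= k)%N -> classC k U g -> classC l U g.
Proof.
move=> /subnK <-; elim: (k - l)%N => // n ih.
by rewrite addSn => /classCS.
Qed.

Lemma continuous_rowP (R : realType) (d : nat) (g : 'rV[R]_d -> R) x :
  {for x, continuous g} -> forall e, 0 < e -> exists2 r : R, 0 < r &
    forall y : 'rV[R]_d, (forall k, `|x ord0 k - y ord0 k| < r) ->
      `|g x - g y| < e.
Proof. by move=> /cvgrPdist_lt cg e /cg/nbhs_rowP. Qed.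

Lemma open_rowP (R : realType) (d : nat) (U : set 'rV[R]_d) x :
  open U -> U x -> exists2 r : R, 0 < r &
    forall y : 'rV[R]_d, (forall k, `|x ord0 k - y ord0 k| < r) -> U y.
Proof. by move=> oU Ux; apply/nbhs_rowP/open_nbhs_nbhs. Qed.

(** * Increments of C^1 functions and the chain rule *)

Lemma partial_increment (R : realType) (d : nat) (g : 'rV[R]_d -> R) i
    (y : 'rV[R]_d) (a e t : R) :
  (forall s, `|s| <= `|t| ->
     derivable g (y + s *: delta_mx ord0 i) (delta_mx ord0 i)) ->
  (forall s, `|s| <= `|t| ->
     `|partial i g (y + s *: delta_mx ord0 i) - a| <= e) ->
  `|g (y + t *: delta_mx ord0 i) - g y - t * a| <= `|t| * e.
Proof.
move=> dg bg.
pose h (s : R) := g (y + s *: delta_mx ord0 i).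
have -> : g y = h 0 by rewrite /h scale0r addr0.
apply: (@mean_value_ineq _ h (fun s => partial i g (y + s *: delta_mx ord0 i))).
  by move=> s st; apply: is_derive_line; exact: dg.
exact: bg.
Qed.

(* Caratheodory's form of differentiability, which turns the chain rule into a
   limit of sums and products. *)
Lemma classC1_increment (R : realType) (d : nat) (U : set 'rV[R]_d) g x :
  open U -> U x -> classC 1 U g ->
  exists q : 'I_d -> 'rV[R]_d -> R,
    (forall h, g (x + h) - g x = \sum_i q i h * h ord0 i) /\
    (forall i, q i h @[h --> (0 : 'rV[R]_d)] --> partial i g x).
Proof.
move=> oU Ux Cg.
(* [tr k h] keeps the first [k] coordinates of [h]. Passing from [x] to [x + h] through the points
   [x + tr k h] changes one coordinate at a time, so the increment telescopes. *)
pose tr k (h : 'rV[R]_d) : 'rV[R]_d :=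
  \row_j (if (j < k)%N then h ord0 j else 0).
have trS (i : 'I_d) (h : 'rV[R]_d) :
    tr i.+1 h = tr i h + h ord0 i *: delta_mx ord0 i.
  apply/rowP => j; rewrite !mxE eqxx/= ltnS leq_eqVlt.
  have [/val_inj ->|ji] := eqVneq (j : nat) i.
    by rewrite ltnn eqxx/= mulr1 add0r.
  by rewrite (_ : j == i = false) ?mulr0 ?addr0//; apply/negbTE.
(* The slope along leg [i]. On a leg of length 0 the quotient would read 0, which would spoil the
   limit, so the limit value is put there. *)
pose q (i : 'I_d) (h : 'rV[R]_d) := if h ord0 i == 0 then partial i g x else
  (g (x + tr i.+1 h) - g (x + tr i h)) / h ord0 i.
exists q; split=> [h|i].
- transitivity (\sum_(0 <= i < d) (g (x + tr i.+1 h) - g (x + tr i h))).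
    rewrite (telescope_sumr (fun k => g (x + tr k h)))//.
    have -> : tr d h = h by apply/rowP => j; rewrite mxE ltn_ord.
    have -> : tr 0%N h = 0 by apply/rowP => j; rewrite !mxE ltn0.
    by rewrite addr0.
  rewrite big_mkord; apply: eq_bigr => i _; rewrite /q.
  case: eqP => [h0|/eqP h0].
    by rewrite h0 mulr0 trS h0 scale0r addr0 subrr.
  by rewrite divfK.
- apply/(@cvgrPdist_le _ _ _ _ (nbhs_filter _)) => e e0.
  have Cgi : {for x, continuous (partial i g)}.
    by apply: classC_continuous Ux; exact: classC_partial Cg.
  have [r r0 rU] := open_rowP oU Ux.
  have [s s0 sg] := continuous_rowP Cgi e0.
  apply/nbhs_rowP; exists (Num.min r s); first by rewrite lt_min r0.
  move=> h hrs; rewrite /q; case: eqP => [h0|/eqP h0].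
    by rewrite subrr normr0 ltW.
  have near_x t k : `|t| <= `|h ord0 i| ->
      `|x ord0 k - (x + tr i h + t *: delta_mx ord0 i) ord0 k| < Num.min r s.
    move=> th; rewrite !mxE eqxx/=.
    have hh j : `|h ord0 j| < Num.min r s.
      by have := hrs j; rewrite mxE sub0r normrN.
    rewrite opprD addrA opprD addrA subrr sub0r -opprD normrN.
    have [->|ki] := eqVneq k i.
      by rewrite ltnn add0r mulr1 (le_lt_trans th).
    rewrite mulr0 addr0; case: ifP => _; first exact: hh.
    by rewrite normr0 (le_lt_trans _ (hh k)).
  have := @partial_increment _ _ g i (x + tr i h) (partial i g x) e (h ord0 i).
  rewrite -[x + _ + _ *: _]addrA -trS => H.
  rewrite distrC -(ler_pM2l (_ : 0 < `|h ord0 i|)) ?normr_gt0// -normrM.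
  rewrite mulrBr mulrCA divff// mulr1; apply: H => t th.
  + apply: classC_derivable Cg _; apply: rU => k.
    by have := near_x t k th; rewrite lt_min => /andP[].
  + rewrite distrC ltW//; apply: sg => k.
    by have := near_x t k th; rewrite lt_min => /andP[].
Qed.

(** With [D h] the increment of [phi], the difference quotient is the sum of
    [q i (D h) * (h^-1 * D h ord0 i)], and each factor converges because [D h] tends to 0. *)
Lemma is_derive_comp_row (R : realType) (V : normedModType R) (d : nat)
    (U : set 'rV[R]_d) (g : 'rV[R]_d -> R) (phi : V -> 'rV[R]_d) (u v : V) :
  open U -> U (phi u) -> classC 1 U g ->
  (forall i, derivable (fun w => phi w ord0 i) u v) ->
  is_derive u v (g \o phi)
    (\sum_i partial i g (phi u) * 'D_v (fun w => phi w ord0 i) u).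
Proof.
move=> oU Uu Cg dphi; have [q [qE qc]] := classC1_increment oU Uu Cg.
pose D (h : R) := phi (h *: v + u) - phi u.
have Dc : D h @[h --> (0 : R)^'] --> (0 : 'rV[R]_d).
  (* Derivability in direction [v] gives continuity along the line through [u]. *)
  have Dic i : (phi (h *: v + u) ord0 i) @[h --> (0 : R)^'] --> phi u ord0 i.
    have /derivable1P/derivable1_diffP/differentiable_continuous := dphi i.
    rewrite /prop_for/continuous_at/= scale0r add0r => c.
    exact: cvg_trans (cvg_app _ (@nbhs_dnbhs R 0)) c.
  move=> A /nbhs_rowP[e e0 eA].
  rewrite nbhs_filterE/= /fmap/=.
  have : \forall h \near (0 : R)^', forall i,
      `|phi u ord0 i - phi (h *: v + u) ord0 i| < e.
    by apply: filter_forall => i; exact: (cvgrPdist_lt _ _).1 (Dic i) _ e0.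
  apply: filterS => h he; apply: eA => k.
  by rewrite /D !mxE sub0r opprB he.
apply: is_derive_cvg.
have -> : (fun h : R => h^-1 * ((g \o phi) (h *: v + u) - (g \o phi) u)) =
    fun h => \sum_i q i (D h) * (h^-1 * D h ord0 i).
  apply/funext => h /=; have -> : phi (h *: v + u) = phi u + D h.
    by rewrite /D [RHS]addrC subrK.
  by rewrite qE mulr_sumr; under eq_bigr do rewrite mulrCA.
apply: cvg_big => [|i _].
  by move=> -[a b]; exact: add_continuous.
apply: cvgM; first exact: cvg_comp Dc (qc i).
rewrite [X in X @ _](_ : _ =
    fun h : R => h^-1 * (phi (h *: v + u) ord0 i - phi u ord0 i)).
  exact: derivable_cvg (dphi i).
by apply/funext => h; rewrite !mxE.
Qed.

(** * Symmetry of mixed partial derivatives *)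

(** Two nested mean value estimates: in direction [i] for the difference of [g] across a step [t] in
    direction [j], then in direction [j] for [partial i g]. *)
Lemma second_difference (R : realType) (d : nat) (U : set 'rV[R]_d) g x
    (i j : 'I_d) (e : R) :
  open U -> U x -> classC 2 U g -> 0 < e -> exists2 r : R, 0 < r &
  forall t, `|t| < r ->
  `|g (x + t *: delta_mx ord0 i + t *: delta_mx ord0 j)
    - g (x + t *: delta_mx ord0 i) - (g (x + t *: delta_mx ord0 j) - g x)
    - t * (t * partial j (partial i g) x)| <= `|t| * (`|t| * e).
Proof.
move=> oU Ux Cg e0.
have Cij := classC_partial j (classC_partial i Cg).
have [r r0 rU] := open_rowP oU Ux.
have [s s0 sg] := continuous_rowP (classC_continuous Cij Ux) e0.
(* Halved because the two displacements, each at most [|t|], add up when [i = j]. *)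
exists (Num.min r s / 2); first by rewrite divr_gt0// lt_min r0.
move=> t tr.
have near_x a b : `|a| <= `|t| -> `|b| <= `|t| ->
    forall k, `|x ord0 k -
      (x + a *: delta_mx ord0 i + b *: delta_mx ord0 j) ord0 k| < Num.min r s.
  move=> at_ bt k; rewrite !mxE eqxx/= opprD addrA opprD addrA subrr sub0r.
  rewrite -opprD normrN (le_lt_trans (ler_normD _ _))// !normrM !normr_nat.
  rewrite (@le_lt_trans _ _ (`|t| + `|t|))//; last by lra.
  have le_t (c : R) (l : bool) : `|c| <= `|t| -> `|c| * l%:R <= `|t|.
    by case: l; rewrite ?mulr1// mulr0.
  by rewrite lerD// le_t.
have Unear a b : `|a| <= `|t| -> `|b| <= `|t| ->
    U (x + a *: delta_mx ord0 i + b *: delta_mx ord0 j).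
  move=> at_ bt; apply: rU => k.
  by have := near_x _ _ at_ bt k; rewrite lt_min => /andP[].
have t0 : `|0 : R| <= `|t| by rewrite normr0.
pose ft (u : R) := g (x + u *: delta_mx ord0 i + t *: delta_mx ord0 j)
  - g (x + u *: delta_mx ord0 i).
have := @mean_value_ineq R ft
  (fun u => partial i g (x + u *: delta_mx ord0 i + t *: delta_mx ord0 j)
    - partial i g (x + u *: delta_mx ord0 i))
  (t * partial j (partial i g) x) (`|t| * e) t.
rewrite /ft scale0r addr0; apply=> u ut.
- apply: is_deriveB.
    under eq_fun do rewrite addrAC.
    rewrite addrAC; apply: is_derive_line; rewrite addrAC.
    by apply: (classC_derivable Cg); exact: Unear.
  apply: is_derive_line; apply: (classC_derivable Cg).
  by have := Unear u 0 ut t0; rewrite scale0r addr0.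
- apply: partial_increment => b bt.
    by apply: (classC_derivable (classC_partial i Cg)); exact: Unear.
  rewrite distrC ltW//; apply: sg => k.
  by have := near_x u b ut bt k; rewrite lt_min => /andP[].
Qed.

(** The second difference is symmetric in [i] and [j], so [t * t] times either mixed partial
    approximates the same number with error at most [t * t * (e / 2)]. *)
Lemma partialC (R : realType) (d : nat) (U : set 'rV[R]_d) g x (i j : 'I_d) :
  open U -> U x -> classC 2 U g ->
  partial i (partial j g) x = partial j (partial i g) x.
Proof.
move=> oU Ux Cg; apply/eqP; rewrite -subr_eq0 -normr_le0.
apply/ler_addgt0Pl => e e0; rewrite addr0.
have e20 : 0 < e / 2 by lra.
have [r r0 rg] := second_difference j i oU Ux Cg e20.
have [s s0 sg] := second_difference i j oU Ux Cg e20.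
pose t := Num.min r s / 2.
have rs0 : 0 < Num.min r s by rewrite lt_min r0.
have t0 : 0 < t by rewrite divr_gt0.
have trs : `|t| < Num.min r s by rewrite gtr0_norm// /t; lra.
move: trs; rewrite lt_min => /andP[/rg {}rg /sg {}sg].
have tt0 : 0 < t * t by rewrite mulr_gt0.
rewrite -(ler_pM2l tt0) -{1}(gtr0_norm tt0) -normrM.
move: rg sg; rewrite [x + t *: delta_mx ord0 j + _]addrAC.
set a := g (_ + _ + _); set b := g (x + _); set c := g (x + _).
rewrite !(gtr0_norm t0) => rg sg.
move: (partial j (partial i g) x) (partial i (partial j g) x) (g x) rg sg.
clearbody a b c t => A B z rg sg.
have -> : t * t * (B - A) =
    (a - c - (b - z) - t * (t * A)) - (a - b - (c - z) - t * (t * B)) by ring.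
apply: le_trans (ler_normB _ _) _.
rewrite (splitr e) !mulrDr -!mulrA; exact: lerD.
Qed.

(** * Locality and reordering of iterated partial derivatives *)

Lemma eq_in_partial (R : realType) (d : nat) (U : set 'rV[R]_d) g g' j :
  open U -> (forall x, U x -> g x = g' x) ->
  forall x, U x -> partial j g x = partial j g' x.
Proof.
move=> oU gg' x Ux; apply: near_eq_derive.
by apply: filterS (open_nbhs_nbhs (conj oU Ux)).
Qed.

Lemma eq_in_derivable (R : realType) (d : nat) (U : set 'rV[R]_d)
    (g g' : 'rV[R]_d -> R) v :
  open U -> (forall x, U x -> g x = g' x) ->
  forall x, U x -> derivable g x v -> derivable g' x v.
Proof.
move=> oU gg' x Ux; apply: near_eq_derivable.
by apply: filterS (open_nbhs_nbhs (conj oU Ux)).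
Qed.

Lemma classC_foldr_partial (R : realType) (d k : nat) (U : set 'rV[R]_d) g
    (s : seq 'I_d) :
  classC (size s + k) U g -> classC k U (foldr (@partial R d) g s).
Proof.
elim: s k => //= j s ih k Cg; apply: classC_partial; apply: ih.
by rewrite addnS.
Qed.

Lemma foldr_partial_front (R : realType) (d : nat) (U : set 'rV[R]_d) g
    (s1 s2 : seq 'I_d) j :
  open U -> classC (size s1 + size s2).+1 U g -> forall x, U x ->
  foldr (@partial R d) g (s1 ++ j :: s2) x =
  foldr (@partial R d) g (j :: s1 ++ s2) x.
Proof.
move=> oU; elim: s1 => // i s1 ih Cg x Ux /=.
rewrite addSn in Cg; apply: etrans (eq_in_partial i oU (ih (classCS Cg)) Ux) _.
apply: partialC oU Ux _; apply: classC_foldr_partial.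
by rewrite size_cat addn2.
Qed.

(** The head of [s] is brought to the front of [t] by adjacent swaps. The tails then agree on the
    whole open set [U], so they may be differentiated once more. *)
Lemma foldr_partial_perm (R : realType) (d : nat) (U : set 'rV[R]_d) g
    (s t : seq 'I_d) :
  open U -> classC (size s) U g -> perm_eq s t -> forall x, U x ->
  foldr (@partial R d) g s x = foldr (@partial R d) g t x.
Proof.
move=> oU; elim: s t => [|j s ih] t Cg st x Ux.
  by move: st; rewrite perm_sym => /perm_nilP ->.
have /path.splitPr E : j \in t by rewrite -(perm_mem st) mem_head.
case: E st => t1 t2 st.
have {}st : perm_eq s (t1 ++ t2).
  by rewrite -(perm_cons j) (perm_trans st)// perm_catC/= perm_cons perm_catC.
have Cg' : classC (size t1 + size t2).+1 U g.
  by rewrite -size_cat -(perm_size st).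
rewrite (foldr_partial_front j oU Cg' Ux).
apply: (eq_in_partial j oU _ Ux) => y; apply: ih => //; exact: classCS.
Qed.

(** * Calculus of growth orders on the cube *)

Section growth.
Variables (R : realType) (d : nat).
Implicit Types (c : 'rV[R]_d) (g : 'rV[R]_d -> R) (u : 'rV[R]_d).

Lemma edge_gt0 (x : R) : 0 < x < 1 -> 0 < edge x.
Proof. by move=> /andP[x0 x1]; rewrite /edge lt_min x0 subr_gt0. Qed.

Lemma edge_le1 (x : R) : 0 < x < 1 -> edge x <= 1.
Proof. by move=> /andP[x0 x1]; rewrite /edge ge_min (ltW x1). Qed.

Lemma open_ucube : open (@ucube R d).
Proof.
rewrite openE => u uU; apply: (@filter_forall _ _
  (fun i => [set v : 'rV[R]_d | 0 < v ord0 i < 1]) _ (nbhs_filter u)) => i.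
apply/nbhs_rowP; exists (edge (u ord0 i)).
  exact: edge_gt0.
move=> y /(_ i); rewrite /edge lt_min !ltr_norml.
move=> /andP[/andP[a b] /andP[e f]].
by apply/andP; split; lra.
Qed.

Definition weight c u : R := \prod_k edge (u ord0 k) `^ c ord0 k.

Lemma weight_gt0 c u : ucube u -> 0 < weight c u.
Proof. by move=> uU; apply: prodr_gt0 => k _; exact/powR_gt0/edge_gt0. Qed.

Lemma weightD c c' u : ucube u -> weight (c + c') u = weight c u * weight c' u.
Proof.
move=> uU; rewrite -big_split/=; apply: eq_bigr => k _; rewrite mxE powRD//.
by rewrite (gt_eqF (edge_gt0 (uU k))) implybT.
Qed.

(** On the cube [edge] takes values in []0, 1]], so larger exponents give smaller weights. *)
Lemma le_weight c c' u : ucube u -> (forall k, c' ord0 k <= c ord0 k) ->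
  weight c u <= weight c' u.
Proof.
move=> uU cc'; apply: ler_prod => k _; rewrite powR_ge0/= ger_powR//.
by rewrite edge_gt0//= edge_le1.
Qed.

(** The loss [B] is arbitrary and can be shared among factors, so that orders add exactly under
    products. *)
Definition bounded_by c g := forall B : R, 0 < B ->
  exists2 C : R, 0 < C & forall u, ucube u ->
    `|g u| <= C * weight (c - const_mx B) u.

Lemma eq_bounded_by c g g' : (forall u, ucube u -> g u = g' u) ->
  bounded_by c g -> bounded_by c g'.
Proof.
by move=> gg' bg B /bg[C C0 gC]; exists C => // u uU; rewrite -gg'// gC.
Qed.

Lemma bounded_byW c c' g : (forall k, c' ord0 k <= c ord0 k) ->
  bounded_by c g -> bounded_by c' g.
Proof.
move=> cc' bg B /bg[C C0 gC]; exists C => // u uU.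
apply: le_trans (gC u uU) _; rewrite ler_pM2l// le_weight// => k.
by rewrite !mxE lerD2r.
Qed.

Lemma bounded_byD c g g' : bounded_by c g -> bounded_by c g' ->
  bounded_by c (fun u => g u + g' u).
Proof.
move=> bg bg' B B0; have [C C0 gC] := bg B B0; have [C' C'0 gC'] := bg' B B0.
exists (C + C') => [|u uU]; first exact: addr_gt0.
by rewrite mulrDl (le_trans (ler_normD _ _))// lerD// ?gC ?gC'.
Qed.

Lemma bounded_byM c c' g g' : bounded_by c g -> bounded_by c' g' ->
  bounded_by (c + c') (fun u => g u * g' u).
Proof.
(* The loss is split evenly between the two factors. *)
move=> bg bg' B B0; have B20 : 0 < B / 2 by rewrite divr_gt0.
have [C C0 gC] := bg _ B20; have [C' C'0 gC'] := bg' _ B20.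
exists (C * C') => [|u uU]; first exact: mulr_gt0.
have -> : c + c' - const_mx B =
    (c - const_mx (B / 2)) + (c' - const_mx (B / 2)).
  by apply/rowP => k; rewrite !mxE; field.
by rewrite weightD// mulrACA normrM ler_pM// ?gC ?gC'.
Qed.

Lemma bounded_by_cst (a : R) : bounded_by 0 (fun=> a).
Proof.
move=> B B0; exists (`|a| + 1) => [|u uU]; first by rewrite ltr_wpDl.
apply: (@le_trans _ _ ((`|a| + 1) * weight 0 u)).
  rewrite /weight big1 => [|k _]; last by rewrite mxE powRr0.
  by rewrite mulr1 lerDl.
rewrite ler_pM2l ?ltr_wpDl// le_weight// => k.
by rewrite !mxE sub0r lerNl oppr0 ltW.
Qed.

Lemma bounded_by0 c : bounded_by c (fun=> 0).
Proof.
move=> B _; exists 1 => // u uU.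
by rewrite normr0 mulr_ge0// ltW// weight_gt0.
Qed.

(* Recursive form of the statement that g has order c for all sublists of l;
   the head of l is the innermost derivative. *)
Fixpoint growth (l : seq 'I_d) c g : Prop :=
  if l is j :: l' then
    [/\ growth l' c g,
        forall u, ucube u -> derivable g u (delta_mx ord0 j) &
        growth l' (c - delta_mx ord0 j) (partial j g)]
  else bounded_by c g.

Lemma eq_growth l c g g' : (forall u, ucube u -> g u = g' u) ->
  growth l c g -> growth l c g'.
Proof.
elim: l c g g' => [|j l ih] c g g' gg'; first exact: eq_bounded_by.
move=> [gl dg dgl]; split; first exact: ih gl.
- by move=> u uU; apply: (eq_in_derivable open_ucube gg') => //; exact: dg.
- by apply: ih dgl => u uU; apply: eq_in_partial uU => //; exact: open_ucube.
Qed.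

Lemma growthW l c c' g : (forall k, c' ord0 k <= c ord0 k) ->
  growth l c g -> growth l c' g.
Proof.
elim: l c c' g => [|j l ih] c c' g cc'; first exact: bounded_byW.
move=> [gl dg dgl]; split=> //; first exact: ih gl.
by apply: ih dgl => k; rewrite !mxE lerD2r.
Qed.

Lemma growthD l c g g' : growth l c g -> growth l c g' ->
  growth l c (fun u => g u + g' u).
Proof.
elim: l c g g' => [|j l ih] c g g'; first exact: bounded_byD.
move=> [gl dg dgl] [g'l dg' dg'l]; split; first exact: ih.
- by move=> u uU; exact: derivableD (dg u uU) (dg' u uU).
- apply: eq_growth (ih _ _ _ dgl dg'l) => u uU.
  exact: esym (deriveD (dg u uU) (dg' u uU)).
Qed.

(** Leibniz rule: whichever factor is differentiated in direction [j], the order of the product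
    drops by [delta_mx ord0 j]. *)
Lemma growthM l c c' g g' : growth l c g -> growth l c' g' ->
  growth l (c + c') (fun u => g u * g' u).
Proof.
elim: l c c' g g' => [|j l ih] c c' g g'; first exact: bounded_byM.
move=> [gl dg dgl] [g'l dg' dg'l]; split; first exact: ih.
- by move=> u uU; exact: derivableM (dg u uU) (dg' u uU).
- have H1 := ih _ _ _ _ gl dg'l; have H2 := ih _ _ _ _ g'l dgl.
  rewrite addrA in H1; rewrite addrA [c' + c]addrC in H2.
  apply: eq_growth (growthD H1 H2) => u uU.
  exact: esym (deriveM (dg u uU) (dg' u uU)).
Qed.

Lemma growth0 l c : growth l c (fun=> 0).
Proof.
elim: l c => [|j l ih] c; first exact: bounded_by0.
split; first exact: ih; first by move=> u _; exact: derivable_cst.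
by apply: eq_growth (ih _) => u _; exact: esym (derive_cst _ _ _).
Qed.

Lemma growth_cst l (a : R) : growth l 0 (fun=> a).
Proof.
elim: l => [|j l ih]; first exact: bounded_by_cst.
split; first exact: ih; first by move=> u _; exact: derivable_cst.
by apply: eq_growth (growth0 _ _) => u _; exact: esym (derive_cst _ _ _).
Qed.

Lemma growth_sum l c (I : Type) (r : seq I) (P : pred I)
    (G : I -> 'rV[R]_d -> R) :
  (forall i, P i -> growth l c (G i)) ->
  growth l c (fun u => \sum_(i <- r | P i) G i u).
Proof.
move=> Gl; elim: r => [|i r ih].
  by apply: eq_growth (growth0 l c) => u _; rewrite big_nil.
case: (boolP (P i)) => Pi.
  apply: eq_growth (growthD (Gl i Pi) ih) => u _.
  by rewrite big_cons Pi.
by apply: eq_growth ih => u _; rewrite big_cons (negbTE Pi).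
Qed.

Lemma growth_prod l (I : Type) (r : seq I) (C : I -> 'rV[R]_d)
    (G : I -> 'rV[R]_d -> R) :
  (forall i, growth l (C i) (G i)) ->
  growth l (\sum_(i <- r) C i) (fun u => \prod_(i <- r) G i u).
Proof.
move=> Gl; elim: r => [|i r ih].
  rewrite big_nil.
  by apply: eq_growth (growth_cst l 1) => u _; rewrite big_nil.
rewrite big_cons.
by apply: eq_growth (growthM (Gl i) ih) => u _; rewrite big_cons.
Qed.

Lemma growthZ l c (a : R) g : growth l c g -> growth l c (fun u => a * g u).
Proof. by move=> gl; rewrite -[c]add0r; exact: growthM (growth_cst l a) gl. Qed.

Lemma growth_comp l (tau : 'rV[R]_d -> 'rV[R]_d) c f :
  classC (size l) setT f ->
  (forall s, (size s <= size l)%N ->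
     bounded_by c (foldr (@partial R d) f s \o tau)) ->
  (forall j i u, ucube u -> derivable (coord_fun tau i) u (delta_mx ord0 j)) ->
  (forall s j i, uniq s ->
     growth s (- delta_mx ord0 j) (partial j (coord_fun tau i))) ->
  uniq l -> growth l c (f \o tau).
Proof.
move=> Cf bf dtau gtau; elim: l f Cf bf => [|j l ih] f Cf bf.
  by move=> _; exact: bf [::] _.
move=> /andP[_ ul].
have chain u : ucube u -> is_derive u (delta_mx ord0 j) (f \o tau)
    (\sum_i partial i f (tau u) * partial j (coord_fun tau i) u).
  move=> uU; apply: (@is_derive_comp_row _ _ _ setT) => //.
  - exact: openT.
  - exact: classCW Cf.
  - by move=> i; exact: dtau.
split.
- apply: ih => //; first exact: classCS.
  by move=> s sl; apply: bf; exact: leqW.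
- by move=> u /chain[].
- apply: (@eq_growth _ _
    (fun u => \sum_i partial i f (tau u) * partial j (coord_fun tau i) u)).
    by move=> u /chain[_ <-].
  apply: growth_sum => i _.
  apply: growthM.
    apply: ih => //; first exact: classC_partial Cf.
    (* The new derivative is innermost, hence last in the list. *)
    by move=> s sl; rewrite -foldr_rcons; apply: bf; rewrite size_rcons.
  exact: gtau.
Qed.

(** The list is reversed because [growth] has the innermost derivative at the head, [foldr] at the
    end. *)
Lemma growth_bounded_by l c g : growth l c g ->
  bounded_by (c - \sum_(j <- l) delta_mx ord0 j)
    (foldr (@partial R d) g (rev l)).
Proof.
elim: l c g => [|j l ih] c g /=; first by rewrite big_nil subr0.
move=> [_ _ /ih]; rewrite big_cons rev_cons -cats1 foldr_cat/=.
by rewrite opprD addrA.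
Qed.

(** Unfolding [growth] either skips or applies each entry of [l], so the derivatives that occur are
    those along subsequences. *)
Lemma growth_of_bounds l c g : (classC (size l) (@ucube R d) g) ->
  (forall s, subseq s l ->
     bounded_by (c - \sum_(j <- s) delta_mx ord0 j)
       (foldr (@partial R d) g (rev s))) ->
  growth l c g.
Proof.
elim: l c g => [|j l ih] c g Cg bg.
  by have := bg [::] isT; rewrite big_nil subr0.
split.
- apply: ih; first exact: classCS.
  by move=> s sl; apply: bg; exact: subseq_trans sl (subseq_cons _ _).
- by move=> u; exact: classC_derivable Cg.
- apply: ih; first exact: classC_partial Cg.
  move=> s sl; have := bg (j :: s).
  rewrite big_cons rev_cons -cats1 foldr_cat/= opprD addrA; apply.
  by rewrite eqxx.
Qed.

(** Supplies the existence clause of the boundary growth condition: the last entry of the list is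
    the outermost derivative. *)
Lemma growth_derivable l c g j : growth (rcons l j) c g ->
  forall u, ucube u ->
  derivable (foldr (@partial R d) g (rev l)) u (delta_mx ord0 j).
Proof.
elim: l c g => [|i l ih] c g /= [gl dg dgl] u uU; first exact: dg.
by rewrite rev_cons -cats1 foldr_cat/=; exact: ih dgl _ uU.
Qed.

End growth.

(** * Coordinate functions; from lists of directions to multi-indices and sets *)

Lemma is_derive_coord (R : realType) (d : nat) (i : 'I_d) (u v : 'rV[R]_d) :
  is_derive u v (fun w : 'rV[R]_d => w ord0 i) (v ord0 i).
Proof.
apply: is_derive_cvg; apply: cvg_near_cst; near=> h.
rewrite !mxE addrK mulrA mulVf ?mul1r//.
by near: h; exact: nbhs_dnbhs_neq.
Unshelve. all: by end_near. Qed.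

Lemma partial_multiE (R : realType) (d : nat) (l : {ffun 'I_d -> nat})
    (g : 'rV[R]_d -> R) :
  partial_multi l g =
  foldr (@partial R d) g (flatten [seq nseq (l j) j | j <- enum 'I_d]).
Proof.
rewrite /partial_multi; elim: (enum 'I_d) => //= j s ->.
by rewrite foldr_cat; elim: (l j) => //= n ->.
Qed.

Lemma perm_flatten_count (T : finType) (s : seq T) :
  perm_eq s (flatten [seq nseq (count_mem j s) j | j <- enum T]).
Proof.
apply/allP => x _ /=; apply/eqP; rewrite count_flatten sumnE 2!big_map.
rewrite big_enum (bigD1 x)//= count_nseq /= eqxx mul1n big1 ?addn0// => j jx.
by rewrite count_nseq /= (negbTE jx).
Qed.

(** The multi-index counts the occurrences of each direction in [s]; symmetry allows the list to be
    sorted. *)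
Lemma foldr_partial_multi (R : realType) (d : nat) (g : 'rV[R]_d -> R)
    (s : seq 'I_d) :
  classC (size s) setT g ->
  exists2 l : {ffun 'I_d -> nat}, (\sum_i l i = size s)%N &
    foldr (@partial R d) g s = partial_multi l g.
Proof.
move=> Cg; exists [ffun j => count_mem j s].
  rewrite [RHS](perm_size (perm_flatten_count s)) size_flatten /shape sumnE.
  rewrite 2!big_map big_enum/=; apply: eq_bigr => i _.
  by rewrite ffunE size_nseq.
rewrite partial_multiE; apply/funext => x.
apply: (foldr_partial_perm openT Cg) => //.
by under eq_map do rewrite ffunE; exact: perm_flatten_count.
Qed.

Lemma foldr_partial_set (R : realType) (d : nat) (U : set 'rV[R]_d)
    (g : 'rV[R]_d -> R) (s : seq 'I_d) :
  open U -> classC (size s) U g -> uniq s -> forall x, U x ->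
  foldr (@partial R d) g s x = partial_set [set j in s] g x.
Proof.
move=> oU Cg us x Ux; apply: (foldr_partial_perm oU Cg) Ux.
by apply: uniq_perm; rewrite ?enum_uniq// => j; rewrite mem_enum inE.
Qed.

Lemma size_uniq_ord (d : nat) (s : seq 'I_d) : uniq s -> (size s <= d)%N.
Proof. by move/card_uniqP => <-; rewrite -[leqRHS]card_ord max_card. Qed.

(** * Computations with weights *)

Section weights.
Variables (R : realType) (d : nat).
Implicit Types (c : 'rV[R]_d) (u : 'rV[R]_d).

Lemma sum_deltaE (s : seq 'I_d) (k : 'I_d) : uniq s ->
  (\sum_(j <- s) delta_mx ord0 j : 'rV[R]_d) ord0 k = (k \in s)%:R.
Proof.
elim: s => [|j s ih] /=; first by rewrite big_nil mxE.
move=> /andP[js /ih {}ih]; rewrite big_cons mxE ih mxE eqxx/= in_cons.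
have [->|_] := eqVneq k j; first by rewrite (negbTE js) addr0.
by rewrite add0r.
Qed.

Lemma weight_delta (m : 'I_d) u : ucube u ->
  weight (- delta_mx ord0 m) u = (edge (u ord0 m))^-1.
Proof.
move=> uU; rewrite /weight (bigD1 m)//= big1 => [|k km].
  by rewrite !mxE !eqxx mulr1 powR_inv1// ltW// edge_gt0.
by rewrite !mxE (negbTE km) andbF oppr0 powRr0.
Qed.

Lemma weight_powR c u (r : R) : ucube u -> weight c u `^ r = weight (r *: c) u.
Proof.
move=> uU; rewrite /weight.
(* Nonnegativity of the partial products is carried along, since [powRM] requires it. *)
suff [] : 0 <= \prod_k edge (u ord0 k) `^ c ord0 k /\
  (\prod_k edge (u ord0 k) `^ c ord0 k) `^ r =
    \prod_k edge (u ord0 k) `^ (r *: c) ord0 k by [].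
elim/big_rec2: _ => [|k x y _ [y0 <-]]; first by rewrite powR1.
split; first exact: mulr_ge0 (powR_ge0 _ _) y0.
by rewrite powRM ?powR_ge0// mxE [r * _]mulrC powRrM.
Qed.

End weights.

(** * Growth of the Jacobian and of compositions with the transport map *)

Section transport.
Variables (R : realType) (d : nat) (tau : 'rV[R]_d -> 'rV[R]_d).
Hypothesis Ctau : forall j, classC d.+1 (@ucube R d) (coord_fun tau j).

(** Assumption (a) as a growth order: the factor [(edge (u ord0 m))^-1] is the weight of
    [- delta_mx ord0 m], and a list without repetitions acts as a set. *)
Lemma growth_partial_tau :
  (forall (v : {set 'I_d}) (m j : 'I_d) (B : R), 0 < B ->
    exists2 C3 : R, 0 < C3 & forall u, ucube u ->
      `|partial_set v (partial m (coord_fun tau j)) u| <=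
        C3 * (edge (u ord0 m))^-1 *
        \prod_(k < d) edge (u ord0 k) `^ (- B - (k \in v)%:R)) ->
  forall s m j, uniq s ->
    growth s (- delta_mx ord0 m) (partial m (coord_fun tau j)).
Proof.
move=> ha s m j us; apply: growth_of_bounds.
  exact: classCW (size_uniq_ord us) (classC_partial m (Ctau j)).
move=> t ts; have ut := subseq_uniq ts us.
have urt : uniq (rev t) by rewrite rev_uniq.
move=> B /(ha [set k in rev t] m j)[C C0 HC]; exists C => // u uU.
rewrite (foldr_partial_set (@open_ucube R d))//; last first.
  by apply: classCW (classC_partial m (Ctau j)); exact: size_uniq_ord.
apply: le_trans (HC u uU) _; rewrite -mulrA -addrA weightD// weight_delta//.
rewrite le_eqVlt; apply/orP; left; apply/eqP; congr (_ * (_ * _)).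
apply: eq_bigr => k _; congr (_ `^ _).
by rewrite !mxE sum_deltaE// addrC inE mem_rev.
Qed.

(** In the Leibniz expansion, the term of a permutation [s] is a product of entries of orders
    [- delta_mx ord0 (s i)]. As [s] is bijective, these sum to -1 in every coordinate. *)
Lemma growth_det_jac l :
  (forall m j, growth l (- delta_mx ord0 m) (partial m (coord_fun tau j))) ->
  growth l (const_mx (-1)) (fun u => \det (jac tau u)).
Proof.
move=> Gtau; apply: growth_sum => s _; apply: growthZ.
have -> : const_mx (-1) = \sum_i (- delta_mx ord0 (s i)) :> 'rV[R]_d.
  transitivity (\sum_i - delta_mx ord0 i : 'rV[R]_d); last exact: (reindex_perm s).
  apply/rowP => k; rewrite summxE (bigD1 k)//= !mxE !eqxx big1 ?addr0// => i ik.
  by rewrite !mxE [k == i]eq_sym (negbTE ik) andbF oppr0.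
apply: eq_growth (growth_prod _ (fun i => Gtau (s i) i)) => u _.
by apply: eq_bigr => i _; rewrite mxE.
Qed.

Lemma det_jac_continuous u : ucube u ->
  {for u, continuous (fun w => \det (jac tau w))}.
Proof.
move=> uU; have FF := nbhs_filter u.
apply: cvg_big => [|s _]; first by move=> -[a b]; exact: add_continuous.
apply: cvgM; first exact: cvg_cst.
apply: cvg_big => [|i _]; first by move=> -[a b]; exact: mul_continuous.
under eq_fun do rewrite mxE; rewrite mxE.
exact: classC_continuous (classC_partial (s i) (Ctau i)) uU.
Qed.

(** Differentiating [sigma (tau u) = u] by the chain rule shows that the Jacobian of [sigma] at
    [tau u] is a left inverse. *)
Lemma det_jac_neq0 (sigma : 'rV[R]_d -> 'rV[R]_d) u :
  (forall u, ucube u -> sigma (tau u) = u) ->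
  (forall j, classC d.+1 setT (coord_fun sigma j)) ->
  ucube u -> \det (jac tau u) != 0.
Proof.
move=> sK Csigma uU.
suff /mulmx1_unit[_] : jac sigma (tau u) *m jac tau u = 1%:M.
  by rewrite unitmxE unitfE.
apply/matrixP => i j; rewrite !mxE.
have [_] : is_derive u (delta_mx ord0 j) (coord_fun sigma i \o tau)
    (\sum_k partial k (coord_fun sigma i) (tau u) * partial j (coord_fun tau k) u).
  apply: (@is_derive_comp_row _ _ _ setT) => //; first exact: openT.
    exact: classCW (Csigma i).
  by move=> k; exact: classC_derivable (Ctau k) uU.
have -> : \sum_k jac sigma (tau u) i k * jac tau u k j =
    \sum_k partial k (coord_fun sigma i) (tau u) * partial j (coord_fun tau k) u.
  by apply: eq_bigr => k _; rewrite !mxE.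
move=> <-; have [_] := is_derive_coord i u (delta_mx ord0 j).
rewrite !mxE eqxx/= eq_sym => <-.
apply: (eq_in_partial j (@open_ucube R d) _ uU) => w wU /=.
by rewrite /coord_fun/= sK.
Qed.

(** As a fixed multiple of the determinant, the absolute value inherits its growth. The multiple is
    the sign at the centre of the cube; the intermediate value theorem on the segment from the
    centre to [u] excludes a change of sign. *)
Lemma norm_det_jac : (forall u, ucube u -> \det (jac tau u) != 0) ->
  exists s : R, forall u, ucube u -> `|\det (jac tau u)| = s * \det (jac tau u).
Proof.
move=> D0; pose D u := \det (jac tau u).
pose u0 : 'rV[R]_d := const_mx (2^-1).
have u0U : ucube u0 by move=> i; rewrite mxE; lra.
exists (Num.sg (D u0)) => u uU; rewrite normrEsg -/(D u).
suff -> : Num.sg (D u) = Num.sg (D u0) by [].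
pose w (t : R) := u0 + t *: (u - u0).
have wU t : t \in `[0, 1] -> ucube (w t).
  rewrite in_itv/= => /andP[t0 t1] i; rewrite !mxE.
  have /andP[a b] := uU i; apply/andP; split; nra.
have cw : {within `[0, 1], continuous (D \o w)}.
  apply: continuous_in_subspaceT => t; rewrite inE => /wU wt.
  apply: continuous_comp; last exact: det_jac_continuous.
  apply: cvgD; first exact: cvg_cst.
  by apply: cvgZr_tmp; exact: cvg_id.
have w0 : w 0 = u0 by rewrite /w scale0r addr0.
have w1 : w 1 = u by rewrite /w scale1r addrC subrK.
have Dw t : t \in `[0, 1] -> (D \o w) t <> 0 by move=> /wU /D0 /eqP.
have := @IVT R (D \o w) 0 1 0 ler01 cw.
rewrite /= w0 w1 => ivt.
have [Du|Du|/eqP Du] := ltrgtP (D u) 0;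
  last by rewrite (negbTE (D0 u uU)) in Du.
- rewrite (ltr0_sg Du); have [Du0|Du0|/eqP Du0] := ltrgtP (D u0) 0.
  + by rewrite ltr0_sg.
  + have [|t /Dw] := ivt; last by [].
    by rewrite ge_min le_max (ltW Du) (ltW Du0) orbT.
  + by rewrite (negbTE (D0 u0 u0U)) in Du0.
- rewrite (gtr0_sg Du); have [Du0|Du0|/eqP Du0] := ltrgtP (D u0) 0.
  + have [|t /Dw] := ivt; last by [].
    by rewrite ge_min le_max (ltW Du) (ltW Du0) orbT.
  + by rewrite gtr0_sg.
  + by rewrite (negbTE (D0 u0 u0U)) in Du0.
Qed.

Lemma bounded_by_moderate (F : R -> R) (f : 'rV[R]_d -> R) :
  (0 < d)%N ->
  (forall B : R, 0 < B -> exists2 C1 : R, 0 < C1 & forall x : 'rV[R]_d,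
     (`|f x|%:E <= C1%:E * \prod_(k < d) negpow (edge (F (x ord0 k))) B)%E) ->
  (exists B0 C4 : R, [/\ 0 < B0, 0 < C4 &
     forall (k : 'I_d) u, ucube u ->
       (negpow (edge (F (tau u ord0 k))) 1 <=
         (C4 * \prod_(l < d) edge (u ord0 l) `^ (- B0))%:E)%E]) ->
  bounded_by 0 (f \o tau).
Proof.
move=> d0 hf [B0 [C4 [B00 C40 hF]]] B B_gt0.
have dR0 : 0 < d%:R :> R by rewrite ltr0n.
pose B1 := B / B0 / d%:R.
have B10 : 0 < B1 by rewrite !divr_gt0.
have [C1 C10 hC1] := hf _ B10.
exists (C1 * C4 `^ (B / B0)) => [|u uU]; first by rewrite mulr_gt0// powR_gt0.
pose M := C4 * weight (const_mx (- B0)) u.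
have M0 : 0 <= M by rewrite ltW// mulr_gt0// weight_gt0.
have hM k : (negpow (edge (F (tau u ord0 k))) 1 <= M%:E)%E.
  apply: le_trans (hF k u uU) _; rewrite lee_fin ler_pM2l// le_eqVlt.
  by apply/orP; left; apply/eqP/eq_bigr => i _; rewrite mxE.
(* The finite bound in (b) excludes [edge = 0], where [negpow] is infinite; elsewhere it is raised
   to the power [B1]. *)
have xM k : edge (F (tau u ord0 k)) != 0 /\
    edge (F (tau u ord0 k)) `^ (- B1) <= M `^ B1.
  have := hM k; rewrite /negpow; case: eqP => // _; rewrite lee_fin => xM.
  split=> //; rewrite -mulN1r powRrM.
  by apply: ge0_ler_powR xM; rewrite ?nnegrE ?powR_ge0// ltW.
have := hC1 (tau u).
rewrite (eq_bigr (fun k => (edge (F (tau u ord0 k)) `^ (- B1))%:E)); last first.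
  by move=> k _; rewrite /negpow (negbTE (xM k).1).
rewrite prodEFin -EFinM lee_fin => /le_trans; apply.
rewrite -mulrA ler_pM2l// (@le_trans _ _ (\prod_(k < d) M `^ B1))//.
  by apply: ler_prod => k _; rewrite powR_ge0 (xM k).2.
rewrite prodr_const card_ord -powR_mulrn ?powR_ge0// -powRrM divfK ?gt_eqF//.
rewrite powRM ?(ltW C40) ?(ltW (weight_gt0 _ uU))// weight_powR//.
rewrite ler_pM2l ?powR_gt0//.
by apply: le_weight => // k; rewrite !mxE mulrN divfK ?gt_eqF// add0r.
Qed.

(** Since [ln (edge _)] is nonpositive, (c) bounds each exponential by [expR (alpha * C')] times
    [edge] to the power [alpha * C5]; the [d] coordinates give the power of [expR (alpha * C')] in
    the constant. *)
Lemma bounded_by_decay (alpha C2 C5 C' : R) (p : 'rV[R]_d -> R) :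
  0 < alpha -> 0 < C2 ->
  (forall x, `|p x| <= C2 * \prod_(k < d) expR (- alpha * `|x ord0 k|)) ->
  (forall (j : 'I_d) u, ucube u ->
    C5 * `|ln (edge (u ord0 j))| - C' <= `|tau u ord0 j|) ->
  bounded_by (const_mx (alpha * C5)) (p \o tau).
Proof.
move=> a0 C20 hp htau B B0.
exists (C2 * expR (alpha * C') ^+ d) => [|u uU].
  by rewrite mulr_gt0// exprn_gt0// expR_gt0.
apply: le_trans (hp _) _; rewrite -mulrA ler_pM2l//.
apply: (@le_trans _ _ (expR (alpha * C') ^+ d * weight (const_mx (alpha * C5)) u)).
  rewrite -[X in _ ^+ X](card_ord d) -prodr_const -big_split/=.
  apply: ler_prod => k _; rewrite expR_ge0/= mxE /powR.
  rewrite (gt_eqF (edge_gt0 (uU k))) -expRD ler_expR.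
  have := htau k u uU; rewrite ler0_norm ?ln_le0 ?edge_le1// => H.
  by nra.
rewrite ler_pM2l ?exprn_gt0 ?expR_gt0//; apply: le_weight => // k.
by rewrite !mxE gerBl ltW.
Qed.

End transport.

(** * Combination of the orders into the boundary growth condition *)

Theorem theorem11 (R : realType) (d : nat) (F : cumulativeBounded (0 : R) (1 : R))
    (alpha : R) (f p : 'rV[R]_d -> R) (tau : 'rV[R]_d -> 'rV[R]_d)
    (hd : (1 <= d)%N)
    (halpha : 0 < alpha)
    (hf : classC d setT f)
    (hp : probability_density p)
    (hpC : classC d setT p)
    (htau : diffeomorphism d.+1 (@ucube R d) setT tau)
    (hi : forall l : {ffun 'I_d -> nat}, (\sum_i l i <= d)%N ->
      forall B : R, 0 < B -> exists2 C1 : R, 0 < C1 & forall x : 'rV[R]_d,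
        (`|partial_multi l f x|%:E <=
           C1%:E * \prod_(k < d) negpow (edge (F (x ord0 k))) B)%E)
    (hii : exists2 C2 : R, 0 < C2 &
      forall l : {ffun 'I_d -> nat}, (\sum_i l i <= d)%N -> forall x : 'rV[R]_d,
        `|partial_multi l p x| <=
          C2 * \prod_(k < d) expR (- alpha * `|x ord0 k|))
    (hiii : transport_growth F alpha tau) :
  boundary_growth (fun u => f (tau u) * p (tau u) * `|\det (jac tau u)|).
Proof.
have [_ Ctau [sigma [sK Csigma]]] := htau.
have [ha hb [C5 [C' [hC5 hc]]]] := hiii.
have [C2 C20 hC2] := hii.
have Gtau := growth_partial_tau Ctau ha.
have multi_le_d g s : classC d setT g -> (size s <= d)%N ->
    exists2 l : {ffun 'I_d -> nat}, (\sum_i l i <= d)%N &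
      foldr (@partial R d) g s = partial_multi l g.
  move=> Cg sd; have [l ls ->] := foldr_partial_multi (classCW sd Cg).
  by exists l => //; rewrite ls.
have [D DE] := norm_det_jac Ctau (fun u => det_jac_neq0 Ctau sK Csigma).
have Gh l : uniq l ->
    growth l 0 (fun u => f (tau u) * p (tau u) * `|\det (jac tau u)|).
  move=> ul; have ld := size_uniq_ord ul.
  have dtau j i u : ucube u -> derivable (coord_fun tau i) u (delta_mx ord0 j).
    exact: classC_derivable (Ctau i).
  have Gf : growth l 0 (f \o tau).
    apply: growth_comp => //; first exact: classCW hf.
    move=> s sl; have [k kd ->] := multi_le_d f s hf (leq_trans sl ld).
    exact: bounded_by_moderate hd (hi k kd) hb.
  have Gp : growth l (const_mx (alpha * C5)) (p \o tau).
    apply: growth_comp => //; first exact: classCW hpC.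
    move=> s sl; have [k kd ->] := multi_le_d p s hpC (leq_trans sl ld).
    exact: bounded_by_decay halpha C20 (hC2 k kd) hc.
  have Gdet := growthZ D (growth_det_jac (fun m j => Gtau l m j ul)).
  have := growthM (growthM Gf Gp) Gdet.
  move/(@growthW _ _ _ _ 0) => Gc.
  apply: eq_growth (Gc _) => [u uU|k]; first by rewrite DE.
  (* Each coordinate of the total order is [alpha * C5 - 1], positive because [C5] exceeds the
     inverse of [alpha]. *)
  rewrite !mxE add0r subr_ge0 ltW// -(mulfV (lt0r_neq0 halpha)).
  by rewrite ltr_pM2l.
split=> [v j u jv uU|B B0].
  (* Reversing [enum v] makes the iterated derivative literally [partial_set v], with [j] applied
     last. *)
  have := @growth_derivable _ _ (rev (enum v)) 0 _ j (Gh _ _) u uU.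
  rewrite revK; apply.
  by rewrite rcons_uniq mem_rev mem_enum jv rev_uniq enum_uniq.
have bv v : exists C : R, 0 < C /\ forall u, ucube u ->
    `|partial_set v (fun u => f (tau u) * p (tau u) * `|\det (jac tau u)|) u| <=
    C * \prod_(j < d) edge (u ord0 j) `^ (- B - (j \in v)%:R).
  have ur : uniq (rev (enum v)) by rewrite rev_uniq enum_uniq.
  have [C C0 HC] := growth_bounded_by (Gh _ ur) B0; exists C; split=> // u uU.
  have := HC u uU; rewrite revK => /le_trans; apply.
  rewrite ler_pM2l// le_eqVlt; apply/orP; left; apply/eqP.
  apply: eq_bigr => k _; congr (_ `^ _).
  by rewrite !mxE sum_deltaE// add0r addrC mem_rev mem_enum.
have [C HC] := choice bv.
(* One constant must serve all [v]: the sum over the finitely many subsets dominates each [C v], and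
   its term at the empty set makes it positive. *)
exists (\sum_v C v) => [|v u uU].
  rewrite (bigD1 finset.set0)//= ltr_wpDr ?(HC finset.set0).1// sumr_ge0// => v _.
  by rewrite ltW// (HC v).1.
apply: le_trans ((HC v).2 u uU) _; apply: ler_wpM2r.
  by apply: prodr_ge0 => k _; exact: powR_ge0.
rewrite (bigD1 v)//= lerDl sumr_ge0// => w _.
by rewrite ltW// (HC w).1.
Qed.
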